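(* For all $n\geq 0$, the number of desarrangements of length $n$ avoiding both $123$ and $231$ is \[ d_n(123,231)=\frac{2n(n-1)+(5-2n)(-1)^n+3}{8}. \]
   Context: Permutations are in one-line notation; $\mathfrak{S}_0$ consists of the empty permutation, which is considered a desarrangement. An index $i\in[n-1]$ is a descent of $\pi\in\mathfrak{S}_n$ if $\pi_i>\pi_{i+1}$; $i\in[n]$ is an ascent if it is not a descent (so $n$ is always an ascent). A desarrangement is a permutation whose first ascent is even. $d_n(\Pi)$ is the number of desarrangements in $\mathfrak{S}_n$ avoiding every pattern in $\Pi$ ($\pi$ avoids $\sigma$ if no subsequence of $\pi$ has the same relative order as $\sigma$). *)

(* Defs.v *)
From mathcomp Require Import all_boot all_order all_algebra all_fingroup.

Set Implicit Arguments.
Unset Strict Implicit.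
Unset Printing Implicit Defensive.

(* A permutation [s : 'S_n] has one-line notation s_1 ... s_n, where the      *)
(* letter s_i is [s j] for the ordinal [j] of value i - 1.  Letters are thus  *)
(* 0-based, which does not affect comparisons; descent and ascent indices are *)
(* kept 1-based, since the definition of desarrangements uses their parity.   *)

Definition is_descent (n : nat) (s : 'S_n) (i : nat) : bool :=
  [exists j : 'I_n, exists k : 'I_n,
     [&& j.+1 == i, k == i :> nat & s k < s j]].

Definition is_ascent (n : nat) (s : 'S_n) (i : nat) : bool :=
  (1 <= i <= n) && ~~ is_descent s i.

Definition is_first_ascent (n : nat) (s : 'S_n) (i : nat) : bool :=
  is_ascent s i && [forall j : 'I_i, ~~ is_ascent s j].

(* The empty permutation has no ascent and is a desarrangement by convention. *)
Definition desarrangement (n : nat) (s : 'S_n) : bool :=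
  (n == 0) || [exists i : 'I_n.+1, is_first_ascent s i && ~~ odd i].

(* A pattern is given by its one-line notation; [f] lists the positions of a  *)
(* subsequence of [s].                                                        *)
Definition contains (n : nat) (s : 'S_n) (p : seq nat) : bool :=
  [exists f : {ffun 'I_(size p) -> 'I_n},
     [forall a : 'I_(size p), forall b : 'I_(size p), (a < b) ==> (f a < f b)] &&
     [forall a : 'I_(size p), forall b : 'I_(size p),
        (s (f a) < s (f b)) == (nth 0 p a < nth 0 p b)]].

Definition avoids (n : nat) (s : 'S_n) (p : seq nat) : bool := ~~ contains s p.

Definition d (n : nat) (Pi : seq (seq nat)) : nat :=
  #|[set s : 'S_n | desarrangement s & all (avoids s) Pi]|.

(* Main.v *)
Require Import Defs.
From mathcomp Require Import all_boot all_order all_algebra all_fingroup.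
From mathcomp Require Import zify ring lra.

Set Implicit Arguments.
Unset Strict Implicit.
Unset Printing Implicit Defensive.

Import GRing.Theory.

(** A permutation is determined by its noninversions, the pairs of positions
    [i < j] with [s i < s j].  Avoiding 123 means that no position is both the
    right end of a noninversion and the left end of another one; avoiding 231
    means that moving the right end of a noninversion further right leaves a
    noninversion.  Hence [s] avoids both exactly when its noninversions form a
    rectangle [[m, k) x [k, n)] of positions.  If the rectangle is nonempty then
    [k], read as a 1-based index, is the first ascent; otherwise [s] is
    decreasing and its first ascent is [n].  Desarrangements thus correspond to
    the pairs [m < k < n] with [k] even and, for even [n], to the decreasing
    permutation. *)

(** * Noninversions *)

Definition noninversion (n : nat) (s : 'S_n) : rel 'I_n :=
  [rel i j : 'I_n | (i < j) && (s i < s j)].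

Lemma noninversionN (n : nat) (s : 'S_n) (i j : 'I_n) :
  i < j -> ~~ noninversion s i j = (s j < s i).
Proof.
move=> lt_ij; rewrite /noninversion /= lt_ij -leqNgt leq_eqVlt.
by rewrite val_eqE (inj_eq perm_inj) -val_eqE /= gtn_eqF.
Qed.

Lemma noninversion_split (n : nat) (s : 'S_n) (i j l : 'I_n) :
  noninversion s i l -> i < j < l -> noninversion s i j || noninversion s j l.
Proof. by rewrite /noninversion /=; lia. Qed.

Lemma perm_ltnE (n : nat) (s : 'S_n) (i j : 'I_n) :
  (s i < s j) = noninversion s i j || (j < i) && ~~ noninversion s j i.
Proof.
case: (ltngtP i j) => [lt_ij | lt_ji | /ord_inj->].
- by rewrite /noninversion /= lt_ij orbF.
- by rewrite noninversionN // orb_idl // => /andP[].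
- by rewrite /noninversion /= !ltnn.
Qed.

Lemma card_ord_ltn (n m : nat) : m <= n -> #|[set i : 'I_n | i < m]| = m.
Proof.
move=> le_mn; rewrite -sum1dep_card.
by rewrite -(big_ord_widen n (fun=> 1) le_mn) sum1_card card_ord.
Qed.

Lemma card_perm_ltn (n : nat) (s : 'S_n) (i : 'I_n) :
  #|[set j | s j < s i]| = s i.
Proof.
have -> : [set j | s j < s i] = s @^-1: [set x : 'I_n | x < s i].
  by apply/setP => j; rewrite !inE.
by rewrite card_preimset ?card_ord_ltn //; [exact/ltnW | exact: perm_inj].
Qed.

Lemma noninversion_inj (n : nat) (s t : 'S_n) :
  noninversion s =2 noninversion t -> s = t.
Proof.
move=> eq_st; apply/permP => i; apply/ord_inj.
rewrite -(card_perm_ltn s) -(card_perm_ltn t); apply: eq_card => j.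
by rewrite !inE !perm_ltnE !eq_st.
Qed.

(** * Avoiding 123 and 231 *)

Lemma contains3P (n : nat) (s : 'S_n) (a b c : nat) : uniq [:: a; b; c] ->
  reflect (exists i j l : 'I_n,
             [/\ i < j < l, (s i < s j) = (a < b), (s i < s l) = (a < c)
               & (s j < s l) = (b < c)])
          (contains s [:: a; b; c]).
Proof.
rewrite /= !inE => abc; apply: (iffP existsP) => /=.
  case=> f /andP[/'forall_'forall_implyP fmono /'forall_'forall_eqP fpat].
  pose o x (lt_x3 : x < 3) := f (Ordinal lt_x3).
  exists (o 0 isT), (o 1 isT), (o 2 isT).
  by split; rewrite ?fpat // !fmono.
case=> i [j [l [ijl sij sil sjl]]].
have [lt_ij lt_jl] := andP ijl; have lt_il := ltn_trans lt_ij lt_jl.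
have := noninversionN s lt_ij; have := noninversionN s lt_il.
have := noninversionN s lt_jl; rewrite /noninversion /= => njl nil nij.
exists [ffun x : 'I_3 => nth i [:: i; j; l] x].
apply/andP; split; apply/'forall_forallP => -[[|[|[|//]]] ?] -[[|[|[|//]]] ?];
  rewrite !ffunE /=; lia.
Qed.

Lemma avoids_123P (n : nat) (s : 'S_n) :
  reflect (forall i j l, noninversion s i j -> ~~ noninversion s j l)
          (avoids s [:: 1; 2; 3]).
Proof.
apply: (iffP idP) => [/contains3P av i j l /andP[ij sij] | av].
  apply/negP => /andP[jl sjl]; case: av => //.
  by exists i, j, l; split=> //; lia.
apply/contains3P => // -[i [j [l [/andP[ij jl] sij _ sjl]]]].
by have := av i j l; rewrite /noninversion /= ij jl sij sjl => /(_ isT).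
Qed.

Lemma avoids_231P (n : nat) (s : 'S_n) :
  reflect (forall i j l : 'I_n,
             noninversion s i j -> j < l -> noninversion s i l)
          (avoids s [:: 2; 3; 1]).
Proof.
apply: (iffP idP) => [/contains3P av i j l /andP[ij sij] jl | av].
  have il := ltn_trans ij jl; apply/negPn; rewrite noninversionN //.
  apply/negP => sli; case: av => //.
  by exists i, j, l; split=> //; lia.
apply/contains3P => // -[i [j [l [/andP[ij jl] sij sil _]]]].
by have := av i j l; rewrite /noninversion /= ij sij sil andbF => /(_ isT jl).
Qed.

Definition rectangle (n k m : nat) : rel 'I_n :=
  [rel i j : 'I_n | (m <= i) && (i < k <= j)].

Arguments rectangle : clear implicits.

Lemma rectangle_avoids (n k m : nat) (s : 'S_n) :
    noninversion s =2 rectangle n k m ->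
  all (avoids s) [:: [:: 1; 2; 3]; [:: 2; 3; 1]].
Proof.
move=> rect; apply/and3P; split=> //.
- by apply/avoids_123P => i j l; rewrite !rect /rectangle /=; lia.
- by apply/avoids_231P => i j l; rewrite !rect /rectangle /=; lia.
Qed.

Lemma upward_closed_threshold (n : nat) (P : pred 'I_n) :
    (forall i j : 'I_n, i <= j -> P i -> P j) ->
  exists k : 'I_n.+1, forall i : 'I_n, P i = (k <= i).
Proof.
move=> upP; pose final k := [forall i : 'I_n, (k <= i) ==> P i].
have final_n : final n by apply/forallP => i; rewrite leqNgt ltn_ord.
have [k /forallP/= finalk mink] := ex_minnP (ex_intro final n final_n).
have lt_kn : k < n.+1 by rewrite ltnS mink.
exists (Ordinal lt_kn) => i; apply/idP/idP => [Pi | ]; last exact/implyP.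
by apply: mink; apply/forallP => j; apply/implyP => /upP; apply.
Qed.

Definition left_end (n : nat) (s : 'S_n) : pred 'I_n :=
  fun i => [exists j, noninversion s i j].

Definition right_end (n : nat) (s : 'S_n) : pred 'I_n :=
  fun j => [exists i, noninversion s i j].

Section AvoiderRectangle.

Variables (n : nat) (s : 'S_n).
Hypotheses (av123 : avoids s [:: 1; 2; 3]) (av231 : avoids s [:: 2; 3; 1]).

Lemma right_end_not_left_end (i : 'I_n) : right_end s i -> ~~ left_end s i.
Proof.
case/existsP => h hi; apply/existsPn => j.
exact: (avoids_123P s av123) hi.
Qed.

Lemma right_end_upward_closed (i j : 'I_n) :
  i <= j -> right_end s i -> right_end s j.
Proof.
rewrite leq_eqVlt => /predU1P[/ord_inj-> // | lt_ij] /existsP[h hi].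
by apply/existsP; exists h; apply: (avoids_231P s av231) hi lt_ij.
Qed.

Lemma left_or_right_end_upward_closed (i j : 'I_n) :
  i <= j -> left_end s i || right_end s i -> left_end s j || right_end s j.
Proof.
move=> le_ij /orP[left_i | /(right_end_upward_closed le_ij)->]; last first.
  exact: orbT.
move: le_ij; rewrite leq_eqVlt => /predU1P[/ord_inj<- | lt_ij].
  by rewrite left_i.
have [l il] := existsP left_i.
have right_j : noninversion s i j -> right_end s j.
  by move=> ij; apply/existsP; exists i.
case: (ltngtP j l) => [lt_jl | lt_lj | /ord_inj j_l].
- have /orP[/right_j-> | jl] :=
    noninversion_split il (introT andP (conj lt_ij lt_jl)); first exact: orbT.
  by apply/orP; left; apply/existsP; exists l.
- by rewrite right_j ?orbT //; apply: (avoids_231P s av231) il lt_lj.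
- by rewrite right_j ?orbT // j_l.
Qed.

Lemma noninversion_left_right (i j : 'I_n) :
  noninversion s i j = left_end s i && right_end s j.
Proof.
apply/idP/andP => [ij | [left_i right_j]].
  by split; apply/existsP; [exists j | exists i].
have lt_ij : i < j.
  apply: contraTltn left_i => le_ji.
  exact/right_end_not_left_end/(right_end_upward_closed le_ji).
have [l il] := existsP left_i.
case: (ltngtP j l) => [lt_jl | lt_lj | /ord_inj-> //].
- have /existsPn/(_ l) not_jl := right_end_not_left_end right_j.
  have := noninversion_split il (introT andP (conj lt_ij lt_jl)).
  by rewrite (negPf not_jl) orbF.
- exact: (avoids_231P s av231) il lt_lj.
Qed.

Lemma avoids_rectangle :
  exists k m : 'I_n.+1, noninversion s =2 rectangle n k m.
Proof.
have [k rightE] := upward_closed_threshold right_end_upward_closed.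
have [m leftE] := upward_closed_threshold left_or_right_end_upward_closed.
exists k, m => i j; rewrite noninversion_left_right /rectangle /=.
rewrite -rightE -leftE ltnNge -rightE.
case: (boolP (right_end s i)) => [/right_end_not_left_end/negPf-> | _].
  by rewrite andbF.
by rewrite orbF.
Qed.

End AvoiderRectangle.

(* All the empty rectangles are represented by [k = n] and [m = 0]. *)
Definition canonical_rectangle (n k m : nat) : bool :=
  (m < k < n) || (k == n) && (m == 0).

Lemma avoids_canonical_rectangle (n : nat) (s : 'S_n) :
    avoids s [:: 1; 2; 3] -> avoids s [:: 2; 3; 1] ->
  exists k m : 'I_n.+1,
    canonical_rectangle n k m /\ noninversion s =2 rectangle n k m.
Proof.
move=> av123 av231; have [k [m rect]] := avoids_rectangle av123 av231.
case: (boolP (m < k < n)) => [mkn | not_mkn].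
  by exists k, m; rewrite /canonical_rectangle mkn.
exists ord_max, ord0; rewrite /canonical_rectangle !eqxx orbT; split=> // i j.
by rewrite rect /rectangle /=; have := ltn_ord j; have := ltn_ord k; lia.
Qed.

Lemma canonical_rectangle_inj (n k m k' m' : nat) :
    canonical_rectangle n k m -> canonical_rectangle n k' m' ->
    rectangle n k m =2 rectangle n k' m' ->
  k = k' /\ m = m'.
Proof.
move=> can can' eq_rect.
have eq_at i j : i < j < n ->
    ((m <= i) && (i < k <= j)) = ((m' <= i) && (i < k' <= j)).
  case/andP=> lt_ij lt_jn.
  exact: (eq_rect (Ordinal (ltn_trans lt_ij lt_jn)) (Ordinal lt_jn)).
move: can can'; rewrite /canonical_rectangle.
have := eq_at k.-1 k; have := eq_at k'.-1 k'; have := eq_at m k.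
have := eq_at m' k'; lia.
Qed.

(** * The permutation with a given rectangle of noninversions *)

(* Three decreasing runs: the [m] largest letters, then the [k - m] smallest
   ones, then the others.  For [k < m], truncated subtraction makes the whole
   word decreasing, in accordance with the empty rectangle. *)
Definition rectangle_letter (n k m i : nat) : nat :=
  if i < m then n - i.+1
  else if i < k then k - i.+1 else n - i.+1 + (k - m).

Lemma rectangle_letter_ltn (n k m i : nat) :
  k <= n -> i < n -> rectangle_letter n k m i < n.
Proof. by rewrite /rectangle_letter; do 2?case: ifP; lia. Qed.

Lemma ltn_rectangle_letter (n k m i j : nat) : i < j < n -> k <= n ->
  (rectangle_letter n k m i < rectangle_letter n k m j) =
  ((m <= i) && (i < k <= j)).
Proof. by rewrite /rectangle_letter; do 4?case: ifP; lia. Qed.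

Section RectanglePerm.

Variables (n : nat) (k : 'I_n.+1) (m : nat).

Definition rectangle_ord (i : 'I_n) : 'I_n :=
  Ordinal (rectangle_letter_ltn m (leq_ord k) (ltn_ord i)).

Lemma rectangle_ord_inj : injective rectangle_ord.
Proof.
move=> i j /(congr1 val) /=; rewrite /rectangle_letter => eq_ij; apply/ord_inj.
have := ltn_ord i; have := ltn_ord j; have := leq_ord k.
by move: eq_ij; do 4?case: ifP; lia.
Qed.

Definition rectangle_perm : 'S_n := perm rectangle_ord_inj.

Lemma noninversion_rectangle_perm :
  noninversion rectangle_perm =2 rectangle n k m.
Proof.
move=> i j; rewrite /noninversion /rectangle /= !permE /=.
case: ltnP => [lt_ij | le_ji] /=; last by lia.
by rewrite ltn_rectangle_letter ?leq_ord // lt_ij ltn_ord.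
Qed.

End RectanglePerm.

(** * Desarrangements *)

Lemma is_first_ascent_uniq (n : nat) (s : 'S_n) (i j : nat) :
  is_first_ascent s i -> is_first_ascent s j -> i = j.
Proof.
move=> /andP[asc_i /forallP first_i] /andP[asc_j /forallP first_j].
case: (ltngtP i j) => // [lt_ij | lt_ji].
  by have := first_j (Ordinal lt_ij); rewrite asc_i.
by have := first_i (Ordinal lt_ji); rewrite asc_j.
Qed.

Lemma desarrangement_first_ascent (n : nat) (s : 'S_n) (k : nat) :
  is_first_ascent s k -> desarrangement s = ~~ odd k.
Proof.
move=> first_k; have /andP[/andP[/andP[k_gt0 le_kn] _] _] := first_k.
rewrite /desarrangement (gtn_eqF (leq_trans k_gt0 le_kn)).
apply/existsP/idP => [[i /andP[first_i]] | even_k].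
  by rewrite (is_first_ascent_uniq first_i first_k).
by exists (Ordinal (le_kn : k < n.+1)); rewrite first_k.
Qed.

Lemma is_descentE (n : nat) (s : 'S_n) (i j : 'I_n) :
  j = i.+1 :> nat -> is_descent s j = ~~ noninversion s i j.
Proof.
move=> jE; rewrite noninversionN ?jE //; apply/existsP/idP => [[i'] | desc].
  case/existsP=> j' /and3P[/eqP[/ord_inj->] /eqP j'E].
  by rewrite (ord_inj (etrans j'E (esym jE))).
by exists i; apply/existsP; exists j; rewrite desc jE !eqxx.
Qed.

Lemma is_ascent_size (n : nat) (s : 'S_n) : is_ascent s n = (0 < n).
Proof.
rewrite /is_ascent leqnn andbT; case: (ltnP 0 n) => //= _.
apply/existsP => -[j /existsP[l /and3P[_ /eqP eq_ln _]]].
by have := ltn_ord l; rewrite eq_ln ltnn.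
Qed.

Lemma rectangle_is_ascent (n k m i : nat) (s : 'S_n) :
    noninversion s =2 rectangle n k m -> 0 < i < n ->
  is_ascent s i = (m < k) && (i == k).
Proof.
case: i => // i rect /= lt_i1n; have lt_in := ltnW lt_i1n.
rewrite /is_ascent /= lt_in.
rewrite (@is_descentE _ s (Ordinal lt_in) (Ordinal lt_i1n)) // negbK.
by rewrite rect /rectangle /=; lia.
Qed.

Lemma rectangle_desarrangement (n k m : nat) (s : 'S_n) :
    canonical_rectangle n k m -> noninversion s =2 rectangle n k m ->
  desarrangement s = ~~ odd k.
Proof.
rewrite /canonical_rectangle => can rect; case: (posnP n) => [n0 | n_gt0].
  by rewrite /desarrangement [n == 0](introT eqP n0); lia.
apply: desarrangement_first_ascent; apply/andP; split.
  case: (eqVneq k n) => [-> | neq_kn]; first by rewrite is_ascent_size.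
  by rewrite (rectangle_is_ascent rect); lia.
apply/forallP => i; have lt_ik := ltn_ord i.
case: (posnP i) => [-> // | i_gt0].
by rewrite (rectangle_is_ascent rect); lia.
Qed.

(** * Enumeration *)

Lemma avoiding_desarrangements_imset (n : nat) :
  [set s : 'S_n | desarrangement s
     & all (avoids s) [:: [:: 1; 2; 3]; [:: 2; 3; 1]]] =
  [set rectangle_perm p.1 p.2 | p : 'I_n.+1 * 'I_n.+1
     & canonical_rectangle n p.1 p.2 && ~~ odd p.1].
Proof.
apply/setP => s; rewrite inE.
apply/andP/imsetP => [[des /and3P[av123 av231 _]] | ].
  have [k [m [can rect]]] := avoids_canonical_rectangle av123 av231.
  exists (k, m).
    by rewrite inE /= can -(rectangle_desarrangement can rect).
  by apply: noninversion_inj => i j; rewrite rect noninversion_rectangle_perm.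
case=> -[k m]; rewrite inE /= => /andP[can even_k] ->.
have rect := @noninversion_rectangle_perm n k m.
split; first by rewrite (rectangle_desarrangement can rect).
exact: rectangle_avoids rect.
Qed.

Lemma rectangle_perm_inj (n : nat) :
  {in [pred p : 'I_n.+1 * 'I_n.+1 | canonical_rectangle n p.1 p.2] &,
   injective (fun p : 'I_n.+1 * 'I_n.+1 => rectangle_perm p.1 p.2)}.
Proof.
move=> [k m] [k' m']; rewrite !inE /= => can can' eq_perm.
have [|/ord_inj-> /ord_inj-> //] := canonical_rectangle_inj can can'.
by move=> i j; rewrite -!noninversion_rectangle_perm eq_perm.
Qed.

Lemma card_even_canonical_rectangle (n : nat) :
  #|[set p : 'I_n.+1 * 'I_n.+1 | canonical_rectangle n p.1 p.2 && ~~ odd p.1]| =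
  \sum_(k < n | ~~ odd k) k + ~~ odd n.
Proof.
rewrite -sum1dep_card.
transitivity (\sum_(k < n.+1 | ~~ odd k)
                \sum_(m < n.+1 | canonical_rectangle n k m) 1).
  by rewrite pair_big_dep /=; apply: eq_bigl => -[k m] /=; rewrite andbC.
rewrite big_mkcond big_ord_recr -big_mkcond /=; congr addn.
  apply: eq_bigr => k _; have lt_kn := ltn_ord k.
  rewrite sum1dep_card -[RHS](@card_ord_ltn n.+1); last by lia.
  by apply: eq_card => m; rewrite !inE /canonical_rectangle /=; lia.
case: (odd n) => //=; rewrite sum1dep_card -[RHS](@card_ord_ltn n.+1) //.
by apply: eq_card => m; rewrite !inE /canonical_rectangle /=; lia.
Qed.

Lemma sum_even_ord (n : nat) :
  \sum_(k < n | ~~ odd k) k = uphalf n * (uphalf n).-1.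
Proof.
elim: n => [|n IH]; first by rewrite big_ord0.
rewrite big_mkcond big_ord_recr -big_mkcond /= IH uphalf_half.
by have := odd_double_half n; case: (odd n) => /=; nia.
Qed.

Lemma d_123_231 (n : nat) :
  d n [:: [:: 1; 2; 3]; [:: 2; 3; 1]] = uphalf n * (uphalf n).-1 + ~~ odd n.
Proof.
rewrite /d avoiding_desarrangements_imset card_in_imset.
  by rewrite card_even_canonical_rectangle sum_even_ord.
move=> p q; rewrite !inE => /andP[can_p _] /andP[can_q _].
exact: rectangle_perm_inj.
Qed.

Theorem theorem3p20 (n : nat) :
  ((d n [:: [:: 1; 2; 3]; [:: 2; 3; 1]]%N)%:R : rat)%R =
  ((2 * n%:R * (n%:R - 1) + (5 - 2 * n%:R) * (-1) ^+ n + 3) / 8)%R.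
Proof.
rewrite d_123_231 uphalf_half -signr_odd.
have nE : (n%:R = (odd n)%:R + 2 * n./2%:R :> rat)%R.
  by rewrite -natrM -natrD mul2n odd_double_half.
rewrite natrD natrM nE.
case: (odd n) => /=; rewrite ?expr0 ?expr1.
  by rewrite add1n /= -natr1; field.
case: n./2 => [|h]; first by field.
by rewrite add0n /= -natr1; field.
Qed.
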